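(* Let $R$ be a strictly local centrality measure and $(G_n)_{n\ge1}$ a sequence of random graphs that converges locally weakly / locally in probability to $(G,o)\sim\mu$. Let $v(C_1(G_n(R,r)))$ denote the number of vertices in the giant (largest connected) component of $G_n(R,r)$, and let $\zeta=\mu(|C_r(o)|=\infty)$. Then, for all $\varepsilon>0$, $$\lim_{n\to\infty}\mathbb{P}\big(v(C_1(G_n(R,r)))\le n(\zeta+\varepsilon)\big)=1.$$
   Context: Graphs are undirected (multi)graphs, with $|V(G_n)|=n$. Centrality: a centrality measure on a graph $G$ is a function $R:V(G)\to\mathbb{R}_{\ge0}$. It is strictly local if there exists $N\in\mathbb{N}$ such that, for each vertex $v\in V(G)$, $R(v)$ depends only on the graph through the neighborhood $B_N^{(G)}(v)$ of vertices at graph distance at most $N$ from $v$. Vertex removal: for a threshold $r$, the $r$-killed graph $G(R,r)$ is the graph obtained from $G$ by removing all the vertices $v$ for which $R(v)>r$. $C_r(o)$ denotes the connected component containing the root in the $r$-killed graph $(G(R,r),o)$ of the limit. Rooted graphs: a rooted (multi)graph $(G,o)$ is a locally finite, connected (multi)graph $G$ with a distinguished vertex $o$. $B_s^{(G)}(o)$ is the subgraph of $G$ spanned by all vertices at graph distance at most $s$ from $o$, rooted at $o$; $\cong$ denotes rooted isomorphism. $\mathscr{G}_\star$ is the space of all rooted (multi)graphs with the metric $d_{\mathscr{G}_\star}((G_1,o_1),(G_2,o_2))=1/(R^\star+1)$, where $R^\star=\sup\{s\ge0: B_s^{(G_1)}(o_1)\cong B_s^{(G_2)}(o_2)\}$.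 Local convergence: $(G_n)_{n\ge1}$ converges locally weakly to the random rooted graph $(G,o)$ with law $\mu$ if for every bounded continuous $f:\mathscr{G}_\star\to\mathbb{R}$, $\lim_{n\to\infty}\mathbb{E}[f(G_n,o_n)]=\mathbb{E}_\mu[f(G,o)]$, where $o_n$ is a uniformly chosen vertex of $G_n$. It converges locally in probability to $(G,o)\sim\mu$ ($\mu$ possibly a random measure) if for every $s>0$ and every $(H,o')\in\mathscr{G}_\star$, $\frac{1}{|V(G_n)|}\sum_{v\in V(G_n)}\mathbf{1}\{B_s^{(G_n)}(v)\cong(H,o')\}\to\mu(B_s^{(G)}(o)\cong(H,o'))$ in probability.
   Formalization: Convergence is taken to be local convergence in probability (μ possibly random); under local weak convergence alone the claim fails, e.g. G_n the n-cycle or the edgeless graph with probability 1/2 each, where ζ=1/2. *)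

(* Defs.v *)
From HB Require Import structures.
From mathcomp Require Import all_boot all_order all_algebra finmap.
From mathcomp Require Import all_classical all_reals all_analysis.

Set Implicit Arguments.
Unset Strict Implicit.
Unset Printing Implicit Defensive.

Import Order.TTheory GRing.Theory Num.Theory.
Import numFieldNormedType.Exports.

Local Open Scope classical_set_scope.
Local Open Scope ring_scope.

(* Locally finite undirected multigraphs, given by edge multiplicities:
   [mult i j] is the number of edges between [i] and [j], and [mult i i] the
   number of self-loops at [i].  Vertices are labelled by natural numbers; a
   finite graph, or a locally finite connected one, has countably many vertices,
   and everything below is invariant under relabelling. *)
Record mgraph := Mgraph {
  vset : set nat;
  mult : nat -> nat -> nat;
  mult_sym : forall i j, mult i j = mult j i;
  mult_vset : forall i j, (0 < mult i j)%N -> vset i;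
  mult_fin : forall i, finite_set [set j | (0 < mult i j)%N] }.

Section induced.
Variables (G : mgraph) (A : set nat).

Let imult i j := if (i \in A) && (j \in A) then mult G i j else 0%N.

Let imult_sym i j : imult i j = imult j i.
Proof. by rewrite /imult andbC mult_sym. Qed.

Let imult_vset i j : (0 < imult i j)%N -> (vset G `&` A) i.
Proof.
rewrite /imult; case: ifP => // /andP[/set_mem Ai _] m0.
by split=> //; exact: mult_vset m0.
Qed.

Let imult_fin i : finite_set [set j | (0 < imult i j)%N].
Proof.
apply: sub_finite_set (mult_fin G i) => j /=.
by rewrite /imult; case: ifP.
Qed.

Definition induced : mgraph := Mgraph imult_sym imult_vset imult_fin.
End induced.

Definition adj (G : mgraph) : rel nat := fun i j => (0 < mult G i j)%N.

Definition walk (G : mgraph) (v w : nat) (p : seq nat) : Prop :=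
  [/\ vset G v, path (adj G) v p & last v p = w].

(* Empty when [v] is not a vertex of [G]. *)
Definition component (G : mgraph) (v : nat) : set nat :=
  [set w | exists p, walk G v w p].

(* The radius is real; [size p] is the number of edges of the walk. *)
Definition gball {R : realType} (G : mgraph) (s : R) (v : nat) : mgraph :=
  induced G [set w | exists2 p, walk G v w p & (size p)%:R <= s].

Definition rooted_iso (G : mgraph) (v : nat) (H : mgraph) (w : nat) : Prop :=
  exists f : nat -> nat,
    [/\ set_bij (vset G) (vset H) f, f v = w &
        forall i j, vset G i -> vset G j -> mult H (f i) (f j) = mult G i j].

(* Rooted graphs are kept as representatives instead of isomorphism classes:
   [gdist] below is then a pseudometric, and its Borel sets are exactly the
   preimages of the Borel sets of the quotient metric space. *)
Record rgraph := Rgraph {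
  rg :> mgraph;
  root : nat;
  root_vset : vset rg root;
  rg_connected : vset rg `<=` component rg root }.

Section rgraph_pointed.
Let pt_graph : mgraph.
Proof.
refine (@Mgraph [set 0%N] (fun _ _ => 0%N) _ _ _) => //.
by move=> i; apply: sub_finite_set (finite_set0 nat).
Defined.

Let pt_connected : vset pt_graph `<=` component pt_graph 0%N.
Proof. by move=> _ ->; exists [::]. Qed.

HB.instance Definition _ := gen_eqMixin rgraph.
HB.instance Definition _ := gen_choiceMixin rgraph.
HB.instance Definition _ :=
  isPointed.Build rgraph (@Rgraph pt_graph 0%N erefl pt_connected).
End rgraph_pointed.

Definition ball_iso {R : realType} (s : R) (G : mgraph) (v : nat) (H : rgraph) :=
  rooted_iso (gball G s v) v H (root H).

Section Gstar.
Variable R : realType.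

(* The supremum is taken in [0, +oo]: [ereal_sup] alone would give -oo when the
   balls of radius 0 already differ, by the number of loops at the root. *)
Definition Rstar (x y : rgraph) : \bar R :=
  Order.max 0%E (ereal_sup [set s%:E | s in [set s : R | 0 <= s /\
    rooted_iso (gball x s (root x)) (root x) (gball y s (root y)) (root y)]]).

(* The inverse of +oo is 0. *)
Definition gdist (x y : rgraph) : R := fine (Rstar x y + 1)^-1%E.

Definition gopen (U : set rgraph) : Prop :=
  forall x, U x -> exists2 e : R, 0 < e & forall y, gdist x y < e -> U y.

Definition Gstar := g_sigma_algebraType gopen.
End Gstar.

(* A centrality measure is a rule assigning to every graph a nonnegative function
   on its vertices; its values off the vertex set are irrelevant. *)
Definition centrality {R : realType} (c : mgraph -> nat -> R) : Prop :=
  forall G v, vset G v -> 0 <= c G v.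

Definition strictly_local {R : realType} (c : mgraph -> nat -> R) : Prop :=
  exists N : nat, forall (G H : mgraph) (v w : nat), vset G v -> vset H w ->
    rooted_iso (gball G (N%:R : R) v) v (gball H (N%:R : R) w) w -> c G v = c H w.

Definition killed {R : realType} (c : mgraph -> nat -> R) (r : R) (G : mgraph) :
  mgraph := induced G [set v | ~ (r < c G v)].

(* For finite graphs; 0 for the graph without vertices. *)
Definition giant_size (G : mgraph) : nat :=
  (\max_(v <- fset_set (vset G)) #|` fset_set (component G v)|)%N.

Definition ball_frequency {R : realType} (s : R) (G : mgraph) (H : rgraph) : R :=
  (#|` fset_set (vset G)|%:R)^-1 *
  \sum_(v <- fset_set (vset G)) \1_[set u | ball_iso s G u H] v.

Section random.
Context {d : measure_display} {Omega : measurableType d} {R : realType}.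
Variable P : probability Omega R.

Definition cvg_in_probability (X : nat -> Omega -> R) (Y : Omega -> R) : Prop :=
  forall e : R, 0 < e ->
    P [set w | e < `|X n w - Y w|] @[n --> \oo] --> 0%E.

(* As [mult] vanishes off the vertex set, this makes every event
   [G = g], with [g] a finite graph, measurable. *)
Definition random_graph (G : Omega -> mgraph) : Prop :=
  (forall i, measurable [set w | vset (G w) i]) /\
  (forall i j, measurable_fun setT (fun w => mult (G w) i j)).

(* The limit law is a random measure, i.e. a probability kernel; a deterministic
   law is a constant kernel. *)
Definition local_cvg_in_probability (G : nat -> Omega -> mgraph)
    (mu : R.-pker Omega ~> Gstar R) : Prop :=
  forall (s : R) (H : rgraph), 0 < s ->
    cvg_in_probability (fun n w => ball_frequency s (G n w) H)
      (fun w => fine (mu w [set x : Gstar R | ball_iso s x (root x) H])).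

Definition zeta (c : mgraph -> nat -> R) (r : R)
    (mu : R.-pker Omega ~> Gstar R) (w : Omega) : R :=
  fine (mu w [set x : Gstar R |
    infinite_set (component (killed c r x) (root x))]).
End random.

(* Main.v *)
From mathcomp Require Import all_boot all_order all_algebra finmap.
From mathcomp Require Import all_classical all_reals all_analysis.
From mathcomp Require Import measurable_realfun lra.
Require Import Defs.

Set Implicit Arguments.
Unset Strict Implicit.
Unset Printing Implicit Defensive.

Import Order.TTheory GRing.Theory Num.Theory.
Import numFieldNormedType.Exports.

Local Open Scope classical_set_scope.
Local Open Scope card_scope.
Local Open Scope ring_scope.

(** Having an infinite component in the killed graph is not a local event, but
    it is the decreasing intersection over [k] of the events [large k]: the
    component has more than [k] vertices.  If the centrality is determined by
    balls of radius [N], then [large k] is determined by the ball of radius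
    [k + N] in the original graph: a component with more than [k] vertices
    contains [k + 1] of them reachable from its root in at most [k] steps, and
    whether such a vertex is killed depends on the ball of radius [N] around it
    ([large_local]).

    In a finite graph all the vertices of one component have the same component,
    so the largest component has at most [k] vertices or else consists of
    vertices satisfying [large k] ([giant_size_le]).  Hence
    [giant_size / n <= max (k / n) (frequency (large k))].

    Local convergence bounds the frequency of any local event from above
    ([local_event_frequency]).  Finite rooted graphs are countably many up to
    isomorphism, so the complement of the event is a countable disjoint union of
    cells, each prescribing the ball up to isomorphism ([complement_cells]).
    Finitely many cells already carry almost all the mass that the limit gives
    to the complement, and the frequencies of these finitely many cells
    converge.  So with high probability the frequency of [large k] is at most its
    mass plus [eps / 2]; and that mass decreases to [zeta] as [k] grows, hence is
    at most [zeta + eps / 2] for a suitable [k], again with high probability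
    since [zeta] is random ([nonincreasing_cvg_prob]).

    Events about the random graph are measurable because it takes only countably
    many values ([measurable_random_graph]), and local events about the limit are
    measurable because they are open ([measurable_local]). *)

(** * Walks and components *)

Lemma mult_vsetr (G : mgraph) i j : (0 < mult G i j)%N -> vset G j.
Proof. by rewrite mult_sym; exact: mult_vset. Qed.

Lemma mult_induced (G : mgraph) (A : set nat) i j :
  A i -> A j -> mult (induced G A) i j = mult G i j.
Proof. by move=> Ai Aj /=; rewrite !mem_set. Qed.

Lemma adj_induced (G : mgraph) (A : set nat) i j :
  adj (induced G A) i j <-> [/\ adj G i j, A i & A j].
Proof.
rewrite /adj /=; case: ifPn.
  by move=> /andP[/set_mem Ai /set_mem Aj]; split=> [//|[]].
by move=> nA; split => // -[_ Ai Aj]; rewrite !mem_set in nA.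
Qed.

Lemma walk_nil (G : mgraph) v : vset G v -> walk G v v [::].
Proof. by []. Qed.

Lemma walk_last (G : mgraph) v w p : walk G v w p -> vset G w.
Proof.
case=> Gv; elim/last_ind: p => [|p x _] /= in w *; first by move=> _ <-.
by rewrite rcons_path last_rcons => /andP[_ /mult_vsetr Gx] <-.
Qed.

Lemma walk_cat (G : mgraph) u v w p q :
  walk G u v p -> walk G v w q -> walk G u w (p ++ q).
Proof.
move=> [Gu pp lp] [_ pq lq]; split=> //; last by rewrite last_cat lp.
by rewrite cat_path pp lp.
Qed.

Lemma walk_edge (G : mgraph) v w : adj G v w -> walk G v w [:: w].
Proof. by move=> vw; split=> //=; [exact: mult_vset vw|rewrite vw]. Qed.

Lemma walk_cons (G : mgraph) v x w p :
  walk G v w (x :: p) <-> adj G v x /\ walk G x w p.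
Proof.
split=> [[Gv /= /andP[vx px] lp]|[vx [Gx px lp]]]; split=> //.
- by split=> //; exact: mult_vsetr vx.
- exact: mult_vset vx.
- by rewrite /= vx.
Qed.

Lemma adj_sym (G : mgraph) i j : adj G i j = adj G j i.
Proof. by rewrite /adj mult_sym. Qed.

Lemma component_sym (G : mgraph) v w : component G v w -> component G w v.
Proof.
case=> p; elim: p v => [|x p IH] v.
  by move=> [Gv _ <-]; exists [::].
move=> /walk_cons[vx /IH[q wq]]; exists (q ++ [:: v]).
by apply: walk_cat wq _; apply: walk_edge; rewrite adj_sym.
Qed.

Lemma component_trans (G : mgraph) u v w :
  component G u v -> component G v w -> component G u w.
Proof. by move=> [p wp] [q wq]; exists (p ++ q); exact: walk_cat wp wq. Qed.

Lemma component_vset (G : mgraph) v : component G v `<=` vset G.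
Proof. by move=> w [p /walk_last]. Qed.

(** * Isomorphisms of balls *)

(** Carrying the inverse along makes the notion symmetric, so that a fact proved
    for [f] also holds for [g]. *)
Definition isom_by (f g : nat -> nat) (G H : mgraph) : Prop :=
  [/\ (forall i, vset G i -> vset H (f i) /\ g (f i) = i),
      (forall j, vset H j -> vset G (g j) /\ f (g j) = j) &
      forall i j, vset G i -> vset G j -> mult H (f i) (f j) = mult G i j].

Lemma isom_by_sym f g G H : isom_by f g G H -> isom_by g f H G.
Proof.
move=> [fP gP fM]; split=> // i j Hi Hj.
have [Gi fgi] := gP _ Hi; have [Gj fgj] := gP _ Hj.
by rewrite -{2}fgi -{2}fgj fM.
Qed.

Lemma isom_by_comp f g f' g' F G H : isom_by f g F G -> isom_by f' g' G H ->
  isom_by (f' \o f) (g \o g') F H.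
Proof.
move=> [fP gP fM] [f'P g'P fM']; split=> /=.
- by move=> i /fP[/f'P[? ->] ->].
- by move=> i /g'P[/gP[? ->] ->].
- by move=> i j Fi Fj; rewrite fM' ?fM //; [case: (fP i)|case: (fP j)].
Qed.

Lemma rooted_isoP G v H w : rooted_iso G v H w <->
  exists f g, isom_by f g G H /\ f v = w.
Proof.
split=> [[f [fbij fv fM]]|[f [g [[fP gP fM] fv]]]]; last first.
  exists f; split=> //; split=> [i /fP[]//|i j /set_mem /fP[_ gi] /set_mem /fP[_ gj] e|].
    by rewrite -gi -gj e.
  by move=> j /gP[Gg fg]; exists (g j).
case: fbij => fun_f inj_f surj_f.
have /choice[g gP] : forall j, exists i, vset H j -> vset G i /\ f i = j.
  move=> j; have [/surj_f[i Gi <-]|nHj] := pselect (vset H j); last by exists 0%N.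
  by exists i.
exists f, g; split=> //; split=> // i Gi; split; first exact: fun_f.
have [Gg fg] := gP _ (fun_f _ Gi).
by apply: inj_f; rewrite ?inE.
Qed.

Lemma rooted_iso_sym G v H w :
  vset G v -> rooted_iso G v H w -> rooted_iso H w G v.
Proof.
move=> Gv /rooted_isoP[f [g [fg fv]]]; apply/rooted_isoP; exists g, f.
split; first exact: isom_by_sym.
by case: fg => /(_ _ Gv)[_ <-]; rewrite fv.
Qed.

Lemma rooted_iso_trans F u G v H w :
  rooted_iso F u G v -> rooted_iso G v H w -> rooted_iso F u H w.
Proof.
move=> /rooted_isoP[f [g [fg fu]]] /rooted_isoP[f' [g' [fg' fv]]].
apply/rooted_isoP; exists (f' \o f), (g \o g'); split=> /=; last by rewrite fu.
exact: isom_by_comp fg fg'.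
Qed.

Lemma rooted_iso_refl G v : rooted_iso G v G v.
Proof. by apply/rooted_isoP; exists id, id. Qed.

Lemma walk_isom f g G H u v p :
  isom_by f g G H -> walk G u v p -> walk H (f u) (f v) (map f p).
Proof.
move=> [fP _ fM]; elim: p u => [|x p IH] u.
  by move=> [/fP[? _] _ <-].
move=> /walk_cons[ux wp]; apply/walk_cons; split; last exact: IH.
by rewrite /adj fM //; [exact: mult_vset ux|exact: mult_vsetr ux].
Qed.

Lemma walk_induced (G : mgraph) (A : set nat) u v p :
  walk (induced G A) u v p -> walk G u v p.
Proof.
elim: p u => [|x p IH] u; first by case=> -[].
by move=> /walk_cons[/adj_induced[ux _ _] /IH wp]; apply/walk_cons.
Qed.

Section ball.
Context {R : realType}.
Implicit Types (s : R) (G H : mgraph).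

Lemma vset_gball G s v w : vset (gball G s v) w <->
  exists2 p, walk G v w p & (size p)%:R <= s.
Proof.
split=> [[]//|vw]; split=> //; case: vw => p /walk_last //.
Qed.

Lemma gball_root G s v : 0 <= s -> vset G v -> vset (gball G s v) v.
Proof. by move=> s0 Gv; apply/vset_gball; exists [::]. Qed.

(** Every prefix of [q ++ p] is a walk from the centre, and is short enough for
    its endpoint to lie in the ball. *)
Lemma walk_gball G s u v w q p : walk G u v q -> walk G v w p ->
  (size q + size p)%:R <= s -> walk (gball G s u) v w p.
Proof.
elim: p q v => [|x p IH] q v wq.
  move=> [Gv _ <-]; rewrite addn0 => qs; split=> //.
  by apply/vset_gball; exists q.
move=> /walk_cons[vx wp] ls; apply/walk_cons; split.
  apply/adj_induced; split=> //.
    exists q => //; apply: le_trans ls; rewrite ler_nat leq_addr //.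
  exists (q ++ [:: x]); first by apply: walk_cat wq _; exact: walk_edge.
  by apply: le_trans ls; rewrite ler_nat size_cat leq_add2l.
apply: (IH (q ++ [:: x])) => //; first by apply: walk_cat wq _; exact: walk_edge.
by rewrite size_cat addn1 addSnnS.
Qed.

Lemma mult_gball G s v i j : vset (gball G s v) i -> vset (gball G s v) j ->
  mult (gball G s v) i j = mult G i j.
Proof. by move=> [_ vi] [_ vj]; rewrite mult_induced. Qed.

Section ball_isom.
Variables (f g : nat -> nat) (G H : mgraph) (s : R) (v w : nat).
Hypothesis fg : isom_by f g (gball G s v) (gball H s w).
Hypothesis (Gv : vset G v) (fv : f v = w).

Lemma walk_gball_isom u q t p : walk G v u q -> walk G u t p ->
  (size q + size p)%:R <= s -> walk H (f u) (f t) (map f p).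
Proof.
move=> wq wp qp; have /(walk_isom fg) := walk_gball wq wp qp.
exact: walk_induced.
Qed.
End ball_isom.

Lemma isom_gball_root f g G H s v w : isom_by f g (gball G s v) (gball H s w) ->
  0 <= s -> vset G v -> f v = w -> vset H w /\ g w = v.
Proof.
move=> [fP _ _] s0 Gv <-; have [] := fP v; first exact: gball_root.
by move=> [].
Qed.

(** An isomorphism of balls restricts to the smaller balls around the inner
    vertices: a walk of length at most [N] from [u] stays in the large ball, so
    it is carried to a walk of the same length from [f u], and [g] carries walks
    back. *)
Lemma isom_gball f g G H s v w u q N : isom_by f g (gball G s v) (gball H s w) ->
  vset G v -> f v = w -> walk G v u q -> (size q + N)%:R <= s ->
  isom_by f g (gball G (N%:R : R) u) (gball H (N%:R : R) (f u)).
Proof.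
move=> fg Gv fv wq qN.
have s0 : 0 <= s by exact: le_trans qN.
have [Hw gw] := isom_gball_root fg s0 Gv fv.
have wu0 : walk G u u [::] by apply: walk_nil; exact: walk_last wq.
have q0 : (size q)%:R <= s by apply: le_trans qN; rewrite ler_nat leq_addr.
have inG i : vset (gball G (N%:R : R) u) i -> vset (gball G s v) i.
  move=> /vset_gball[p wp pN]; apply/vset_gball; exists (q ++ p).
    exact: walk_cat wq wp.
  by apply: le_trans qN; rewrite ler_nat size_cat leq_add2l -(ler_nat R).
have wq' : walk H w (f u) (map f q).
  by rewrite -fv; apply: (walk_gball_isom fg (walk_nil Gv)).
have qN' : (size (map f q) + N)%:R <= s by rewrite size_map.
have gfu : g (f u) = u by case: fg => /(_ u)[|_ ->] //; apply/vset_gball; exists q.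
have gf := isom_by_sym fg.
have [fP gP fM] := fg.
have fB i : vset (gball G (N%:R : R) u) i -> vset (gball H (N%:R : R) (f u)) (f i).
  move=> /vset_gball[p wp pN]; apply/vset_gball; exists (map f p).
    apply: (walk_gball_isom fg wq wp); apply: le_trans qN.
    by rewrite ler_nat leq_add2l -(ler_nat R).
  by rewrite size_map.
have gB i : vset (gball H (N%:R : R) (f u)) i ->
    vset (gball G (N%:R : R) u) (g i) /\ vset (gball H s w) i.
  move=> /vset_gball[p wp pN].
  have ls : (size (map f q) + size p)%:R <= s.
    by apply: le_trans qN'; rewrite ler_nat leq_add2l -(ler_nat R).
  split; apply/vset_gball.
    exists (map g p); last by rewrite size_map.
    by rewrite -gfu; apply: (walk_gball_isom gf wq' wp).
  exists (map f q ++ p); first exact: walk_cat wq' wp.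
  by rewrite size_cat.
split.
- by move=> i Bi; split; [exact: fB|case: (fP i (inG _ Bi))].
- by move=> j /gB[Bj Hj]; split=> //; case: (gP j Hj).
- move=> i j Bi Bj; have [Bi' Bj'] := (inG _ Bi, inG _ Bj).
  rewrite mult_gball ?mult_gball; [|exact: Bi|exact: Bj|exact: fB|exact: fB].
  rewrite -(mult_gball (fP _ Bi').1 (fP _ Bj').1) fM //.
  exact: mult_gball.
Qed.

Lemma ball_iso_le (s : R) (N : nat) G H v w : N%:R <= s -> vset G v ->
  rooted_iso (gball G s v) v (gball H s w) w ->
  rooted_iso (gball G (N%:R : R) v) v (gball H (N%:R : R) w) w.
Proof.
move=> Ns Gv /rooted_isoP[f [g [fg fv]]]; apply/rooted_isoP; exists f, g.
by split=> //; rewrite -fv; exact: (isom_gball fg Gv fv (walk_nil Gv)).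
Qed.

End ball.

(** * Large components *)

(** Explorations of the component of [v], the most recent vertex first.  Listing
    the vertices, rather than counting the component, gives a finite certificate
    that lies near [v] and can be carried along an isomorphism of balls. *)
Inductive cluster (K : mgraph) (v : nat) : seq nat -> Prop :=
| cluster_root : vset K v -> cluster K v [:: v]
| cluster_grow u t s : cluster K v s -> t \in s -> adj K t u -> u \notin s ->
    cluster K v (u :: s).

(** The certificate form of: the component of [v] has more than [k] vertices. *)
Definition large (k : nat) (K : mgraph) (v : nat) : Prop :=
  exists2 s, cluster K v s & size s = k.+1.

Lemma cluster_uniq K v s : cluster K v s -> uniq s.
Proof. by elim=> // u t {}s _ us _ _ nus /=; rewrite nus. Qed.

(** Each new vertex is one step away from an earlier one, so an exploration by
    [k + 1] vertices stays within distance [k] of its root. *)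
Lemma cluster_walk K v s : cluster K v s ->
  forall u, u \in s -> exists2 p, walk K v u p & (size p < size s)%N.
Proof.
elim=> [Kv u|u t {}s _ IH ts tu _ x]; rewrite inE.
  by move=> /eqP ->; exists [::].
move=> /predU1P[->|/IH[p wp ps]]; last by exists p => //; exact: ltnW.
have [p wp ps] := IH _ ts; exists (p ++ [:: u]).
  by apply: walk_cat wp _; exact: walk_edge.
by rewrite size_cat addn1.
Qed.

Lemma cluster_component K v s u : cluster K v s -> u \in s -> component K v u.
Proof. by move=> /cluster_walk h /h[p wp _]; exists p. Qed.

Lemma large_vset k K v : large k K v -> vset K v.
Proof. by case=> s Cs _; elim: Cs. Qed.

Lemma large_leq k m K v : (k <= m)%N -> large m K v -> large k K v.
Proof.
move=> /subnK <-; elim: (m - k)%N => [//|j IH] [s Cs sz]; apply: IH.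
by case: Cs sz => // u t s' Cs' _ _ _ [sz]; exists s'.
Qed.

Lemma walk_exit K (s : seq nat) x y p : walk K x y p -> x \in s -> y \notin s ->
  exists t u, [/\ t \in s, adj K t u & u \notin s].
Proof.
elim: p x => [|z p IH] x; first by move=> [_ _ /= ->] ->.
move=> /walk_cons[xz wp] xs ys.
by have [zs|zs] := boolP (z \in s); [exact: IH wp zs ys|exists x, z].
Qed.

Lemma cluster_extend K v s : cluster K v s ->
  ~ (component K v `<=` [set` s]) -> exists u, cluster K v (u :: s).
Proof.
move=> Cs /existsNP[y /not_implyP[[p wp]] /= /negP ys].
have vs : v \in s.
  by elim: Cs {ys} => [_|u t s' _ vs _ _ _]; rewrite inE ?eqxx // vs orbT.
have [t [u [ts tu us]]] := walk_exit wp vs ys.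
by exists u; exact: cluster_grow Cs ts tu us.
Qed.

(** An exploration that does not yet cover the component can be continued along
    the first edge that leaves it. *)
Lemma large_growth K v k : vset K v ->
  (forall s : seq nat, (size s <= k)%N -> ~ (component K v `<=` [set` s])) ->
  large k K v.
Proof.
move=> Kv; elim: k => [|k IH] small.
  by exists [:: v] => //; exact: cluster_root.
case: IH => [s sk|s Cs sk]; first exact: small (leqW sk).
have [|u Cu] := cluster_extend Cs; first by apply: small; rewrite sk.
by exists (u :: s) => //=; rewrite sk.
Qed.

Lemma infinite_componentP K v :
  infinite_set (component K v) <-> forall k, large k K v.
Proof.
split=> [inf k|lK fin].
  have Kv : vset K v.
    apply: contrapT => nKv; apply: inf; apply: sub_finite_set (finite_set0 nat).
    by move=> w [p []].
  by apply: large_growth => // s _ sub; apply: inf; apply: sub_finite_set sub _.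
have [s Cs sz] := lK #|` fset_set (component K v)|.
have /fsubset_leq_card : ([fset x in s] `<=` fset_set (component K v))%fset.
  apply/fsubsetP => x; rewrite !inE /= => xs; rewrite in_fset_set // inE.
  exact: cluster_component Cs xs.
rewrite card_fseq undup_id; last exact: cluster_uniq Cs.
by rewrite sz ltnn.
Qed.

(** The components of [v] and [w] coincide, so the bound on the first one lets the
    exploration from [w] go on. *)
Lemma large_component K v k : finite_set (vset K) ->
  (k < #|` fset_set (component K v)|)%N -> forall w, component K v w -> large k K w.
Proof.
move=> finK kC w vw.
have finC : finite_set (component K v) by exact: sub_finite_set (@component_vset K v) _.
apply: large_growth => [|s sk sub]; first exact: component_vset vw.
have /fsubset_leq_card : (fset_set (component K v) `<=` [fset x in s])%fset.
  apply/fsubsetP => x; rewrite in_fset_set // !inE /= => vx; apply: sub.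
  exact: component_trans (component_sym vw) vx.
rewrite leqNgt => /negP; apply; apply: leq_ltn_trans kC.
by rewrite card_fseq (leq_trans (size_undup s)).
Qed.

(** A component with more than [k] vertices is contained in the set of vertices
    satisfying [large k]; all the others have at most [k] vertices. *)
Lemma giant_size_le K k : finite_set (vset K) ->
  (giant_size K <= maxn k #|` fset_set [set v | large k K v]|)%N.
Proof.
move=> finK; apply/bigmax_leqP_seq => v _ _.
have [Ck|kC] := leqP #|` fset_set (component K v)| k.
  by rewrite leq_max Ck.
rewrite leq_max; apply/orP; right; apply: fsubset_leq_card.
have finL : finite_set [set v | large k K v].
  by apply: sub_finite_set finK => w /large_vset.
have finC : finite_set (component K v) by exact: sub_finite_set (@component_vset K v) _.
rewrite -fset_set_sub //; exact: large_component.
Qed.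

Section killed_large.
Context {R : realType}.
Variables (c : mgraph -> nat -> R) (N : nat).
Hypothesis c_local : forall (G H : mgraph) (v w : nat), vset G v -> vset H w ->
    rooted_iso (gball G (N%:R : R) v) v (gball H (N%:R : R) w) w -> c G v = c H w.
Variable r : R.

(** The explored vertices are within distance [k] of the root, so their balls of
    radius [N], which decide whether they are killed, lie in the ball of radius
    [k + N]. *)
Lemma cluster_isom f g (G H : mgraph) k v w t :
  isom_by f g (gball G ((k + N)%:R : R) v) (gball H ((k + N)%:R : R) w) ->
  vset G v -> f v = w -> cluster (killed c r G) v t -> (size t <= k.+1)%N ->
  cluster (killed c r H) w (map f t).
Proof.
move=> fg Gv fv Ct.
have [fP _ fM] := fg.
have cE u p : walk G v u p -> (size p <= k)%N ->
    [/\ vset (gball G ((k + N)%:R : R) v) u, vset H (f u) & c H (f u) = c G u].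
  move=> wp pk.
  have Bu : vset (gball G ((k + N)%:R : R) v) u.
    by apply/vset_gball; exists p => //; rewrite ler_nat (leq_trans pk) ?leq_addr.
  have [[Hfu _] _] := fP _ Bu.
  split=> //; apply/esym/c_local => //; first exact: walk_last wp.
  apply/rooted_isoP; exists f, g; split=> //.
  by apply: (isom_gball fg Gv fv wp); rewrite ler_nat leq_add2r.
(* [cE]: the centrality agrees at [u] and [f u] as long as [u] is within [k]. *)
elim: Ct => [[_ ncv]|u x {}t Ct IH xt xu ut] tk.
  rewrite /= fv; apply: cluster_root.
  have [//|_ Hw cw] := cE _ _ (walk_nil Gv); rewrite fv in Hw cw.
  by split=> //; rewrite /= cw.
have /= tk' : (size t <= k)%N by [].
have [p wp pt] := cluster_walk Ct xt.
move/walk_induced: wp => wp.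
have [Bx Hfx cx] := cE _ _ wp (leq_trans (ltnW pt) tk').
have [xu' ncx ncu] := (adj_induced _ _ _ _).1 xu.
have wpu : walk G v u (p ++ [:: u]) by apply: walk_cat wp _; exact: walk_edge.
have [|Bu Hfu cu] := cE _ _ wpu.
  by rewrite size_cat addn1 (leq_trans pt).
apply: (@cluster_grow _ _ _ (f x)).
- by apply: IH; exact: leqW.
- exact: map_f.
- apply/adj_induced; split; rewrite /= ?cx ?cu //.
  rewrite /adj -(mult_gball (fP _ Bx).1 (fP _ Bu).1) fM //.
  by rewrite mult_gball.
- apply/mapP => -[y yt fuy].
  have [q wq qt] := cluster_walk Ct yt.
  have [By _ _] := cE _ _ (walk_induced wq) (leq_trans (ltnW qt) tk').
  by move: ut; rewrite -(fP _ Bu).2 fuy (fP _ By).2 yt.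
Qed.

Lemma large_local k (G H : mgraph) v w : vset G v ->
  rooted_iso (gball G ((k + N)%:R : R) v) v (gball H ((k + N)%:R : R) w) w ->
  large k (killed c r G) v -> large k (killed c r H) w.
Proof.
move=> Gv /rooted_isoP[f [g [fg fv]]] [t Ct tk]; exists (map f t).
  by apply: (cluster_isom fg) => //; rewrite tk.
by rewrite size_map.
Qed.
End killed_large.

(** * Local events of the limit are measurable *)

Section local_sets.
Context {R : realType}.

(** If the distance is less than [1 / (S + 1)], the supremum [Rstar] exceeds [S],
    so the balls are isomorphic at some radius above [S], hence at [S]. *)
Lemma gdist_lt_ball_iso (S : nat) (x y : rgraph) :
  gdist R x y < S.+1%:R^-1 ->
  rooted_iso (gball x (S%:R : R) (root x)) (root x)
             (gball y (S%:R : R) (root y)) (root y).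
Proof.
rewrite /gdist; set m := Rstar R x y => dxy.
have m0 : (0 <= m)%E by rewrite /m /Rstar le_max lexx.
have Sm : (S%:R%:E < m)%E.
  rewrite ltNge; apply/negP => mS; move: dxy; rewrite ltNge => /negP; apply.
  case: m m0 mS => [m| |] //; rewrite !lee_fin => m0 mS.
  have m1 : 0 < m + 1 by rewrite ltr_wpDl.
  rewrite -EFinD inver gt_eqF //= lef_pV2 ?posrE //.
  by rewrite -natr1 lerD2r.
move: Sm; rewrite /m /Rstar lt_max lte_fin ltrn0 /=.
move=> /ereal_sup_gt[_ [s [s0 iso] <-]]; rewrite lte_fin => /ltW Ss.
by apply: ball_iso_le Ss _ iso; exact: root_vset.
Qed.

Lemma measurable_local (S : nat) (Q : set rgraph) :
  (forall x y : rgraph, Q x ->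
    rooted_iso (gball x (S%:R : R) (root x)) (root x)
               (gball y (S%:R : R) (root y)) (root y) -> Q y) ->
  measurable (Q : set (Gstar R)).
Proof.
move=> QS; apply: sub_sigma_algebra => x Qx.
exists S.+1%:R^-1; first by rewrite invr_gt0.
by move=> y /gdist_lt_ball_iso; exact: QS Qx.
Qed.

Lemma ball_iso_iso (s : R) (G G' : mgraph) v v' (H : rgraph) :
  0 <= s -> vset G' v' -> ball_iso s G v H -> ball_iso s G' v' H ->
  rooted_iso (gball G s v) v (gball G' s v') v'.
Proof.
move=> s0 Gv' vH vH'; apply: rooted_iso_trans vH _.
by apply: rooted_iso_sym vH'; exact: gball_root.
Qed.

Lemma measurable_ball_iso (S : nat) (H : rgraph) :
  measurable ([set x : rgraph | ball_iso (S%:R : R) x (root x) H] : set (Gstar R)).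
Proof.
apply: (@measurable_local S) => x y xH xy.
apply: rooted_iso_trans xH; apply: rooted_iso_sym xy.
by apply: gball_root => //; exact: root_vset.
Qed.

Lemma finite_gball (G : mgraph) v n : finite_set (vset (gball G (n%:R : R) v)).
Proof.
elim: n => [|n IH].
  apply: sub_finite_set (finite_set1 v) => w /vset_gball[[|x p] wp].
    by case: wp => _ _ <-.
  by rewrite ler_nat.
have fin : finite_set ([set v] `|` \bigcup_(u in vset (gball G (n%:R : R) v))
    [set w | (0 < mult G u w)%N]).
  rewrite finite_setU; split=> //; apply: bigcup_finite => // u _.
  exact: mult_fin.
apply: sub_finite_set fin => w /vset_gball[p]; case/lastP: p => [|p x].
  by move=> [_ _ <-] _; left.
move=> [Gv]; rewrite rcons_path last_rcons => /andP[pp px] xw.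
rewrite size_rcons ler_nat ltnS => pn; right; exists (last v p).
  by apply/vset_gball; exists p => //; rewrite ler_nat.
by rewrite /= -xw.
Qed.

End local_sets.

(** * Countability of finite graphs *)

Lemma mgraph_ext (g h : mgraph) : vset g = vset h ->
  (forall i j, mult g i j = mult h i j) -> g = h.
Proof.
case: g h => [V m s mv mf] [V' m' s' mv' mf'] /= VV mm.
have {}mm : m = m' by apply/funext => i; apply/funext => j.
by subst V' m'; congr Mgraph; exact: Prop_irrelevance.
Qed.

(** Multiplicities vanish off the vertices, so a finite graph is determined by
    finitely many numbers. *)
Lemma countable_finite_mgraph : countable [set g : mgraph | finite_set (vset g)].
Proof.
pose V (g : mgraph) := fset_set (vset g).
pose code (g : mgraph) := (V g,
  [seq mult g p.1 p.2 | p <- [seq (i, j) | i <- V g, j <- V g]]).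
apply/countable_injP; exists (choice.pickle \o code) => g h.
move=> /set_mem fg /set_mem fh /(pcan_inj choice.pickleK)[Vgh mgh].
have vgh : vset g = vset h.
  by rewrite -(fset_setK fg) -(fset_setK fh) -/(V g) Vgh.
apply: mgraph_ext => // i j.
have zero (k : mgraph) : ~ (vset k i /\ vset k j) -> mult k i j = 0%N.
  move=> nij; apply/eqP; rewrite -leqn0 leqNgt; apply/negP => kij.
  by apply: nij; split; [exact: mult_vset kij|exact: mult_vsetr kij].
have [[gi gj]|nij] := pselect (vset g i /\ vset g j); last first.
  by rewrite !zero // -vgh.
move: mgh; rewrite -Vgh => /eq_in_map /(_ (i, j)); apply.
by apply/allpairsP; exists (i, j); split; rewrite //= /V in_fset_set ?inE.
Qed.

Lemma rgraph_ext (x y : rgraph) : rg x = rg y -> root x = root y -> x = y.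
Proof.
case: x y => [g v gv gc] [h w hw hc] /= gh vw.
by subst h w; congr Rgraph; exact: Prop_irrelevance.
Qed.

Lemma finite_rgraph_enum : exists H : nat -> rgraph,
  forall x : rgraph, finite_set (vset x) -> exists i, H i = x.
Proof.
have /countable_injP[f f_inj] := countable_finite_mgraph.
pose code (x : rgraph) := choice.pickle (f x, root x).
have /choice[H HP] : forall n, exists x : rgraph,
    (exists y : rgraph, finite_set (vset y) /\ code y = n) ->
    finite_set (vset x) /\ code x = n.
  by move=> n; have [[y yP]|no] := pselect (exists y : rgraph,
    finite_set (vset y) /\ code y = n); [exists y|exists point].
exists H => x finx; exists (code x).
have [|finH /(pcan_inj choice.pickleK)[fHx rHx]] := HP (code x); first by exists x.
by apply: rgraph_ext => //; apply: f_inj; rewrite ?inE.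
Qed.

(** * Splitting the complement of a local event into cells *)

Section cells.
Context {R : realType}.
Variables (S : nat) (L : mgraph -> nat -> Prop).
Hypothesis L_local : forall (G H : mgraph) v w, vset G v ->
  rooted_iso (gball G (S%:R : R) v) v (gball H (S%:R : R) w) w -> L G v -> L H w.

(** The ball around the root is its own representative among finite rooted
    graphs. *)
Let ball_rgraph (x : rgraph) : rgraph.
Proof.
apply: (@Rgraph (gball x (S%:R : R) (root x)) (root x)).
  by apply: gball_root => //; exact: root_vset.
move=> u /vset_gball[p wp ps]; exists p.
by apply: walk_gball (walk_nil _) wp ps; exact: root_vset.
Defined.

(** Each finite rooted graph prescribes a ball up to isomorphism.  In an
    enumeration of these graphs, [D] keeps the first one of each isomorphism
    class, and only the classes that force the event to fail; by locality, every
    failure of the event falls in a class of this kind. *)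
Lemma complement_cells : exists (H : nat -> rgraph) (D : pred nat),
  [/\ forall (G : mgraph) v i, vset G v -> D i ->
        ball_iso (S%:R : R) G v (H i) -> ~ L G v,
      forall (G : mgraph) v i j, vset G v -> D i -> D j ->
        ball_iso (S%:R : R) G v (H i) -> ball_iso (S%:R : R) G v (H j) -> i = j &
      forall x : rgraph, ~ L x (root x) ->
        exists2 i, D i & ball_iso (S%:R : R) x (root x) (H i)].
Proof.
have [H HP] := finite_rgraph_enum.
pose new i := forall j, (j < i)%N -> ~ rooted_iso (H j) (root (H j)) (H i) (root (H i)).
pose off i := forall (G : mgraph) v, vset G v ->
  ball_iso (S%:R : R) G v (H i) -> ~ L G v.
exists H, (fun i => `[< new i /\ off i >]); split.
- by move=> G v i Gv /asboolP[_ offi]; exact: offi.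
- have lt_false (G : mgraph) v i j : vset G v -> new j ->
      ball_iso (S%:R : R) G v (H i) -> ball_iso (S%:R : R) G v (H j) -> ~ (i < j)%N.
    move=> Gv newj vi vj ij; apply: (newj i ij); apply: rooted_iso_trans vj.
    by apply: rooted_iso_sym vi; exact: gball_root.
  move=> G v i j Gv /asboolP[newi _] /asboolP[newj _] vi vj.
  apply/eqP; rewrite eqn_leq leqNgt [(j <= i)%N]leqNgt.
  apply/andP; split; apply/negP.
    exact: lt_false Gv newi vj vi.
  exact: lt_false Gv newj vi vj.
- move=> x nLx.
  have exi : exists i, `[< ball_iso (S%:R : R) x (root x) (H i) >].
    have [|i Hi] := HP (ball_rgraph x); first exact: finite_gball.
    by exists i; apply/asboolP; rewrite /ball_iso Hi; exact: rooted_iso_refl.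
  case: (ex_minnP exi) => i /asboolP xi mini; exists i => //; apply/asboolP; split.
    move=> j ji ijso; suff : (i <= j)%N by rewrite leqNgt ji.
    apply: mini; apply/asboolP; apply: rooted_iso_trans xi _.
    by apply: rooted_iso_sym ijso; exact: root_vset.
  move=> G v Gv vi LGv; apply: nLx; apply: L_local LGv => //.
  apply: ball_iso_iso vi xi => //; exact: root_vset.
Qed.

(** A vertex satisfies the event or lies in at most one of the cells, so it is
    counted at most once on the left. *)
Lemma frequency_cells_le (H : nat -> rgraph) (D : pred nat) (G : mgraph) M :
  (forall v i, vset G v -> D i -> ball_iso (S%:R : R) G v (H i) -> ~ L G v) ->
  (forall v i j, vset G v -> D i -> D j ->
    ball_iso (S%:R : R) G v (H i) -> ball_iso (S%:R : R) G v (H j) -> i = j) ->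
  finite_set (vset G) -> [set v | L G v] `<=` vset G ->
  \sum_(i < M | D i) ball_frequency (S%:R : R) G (H i) +
    #|` fset_set (vset G)|%:R^-1 * #|` fset_set [set v | L G v]|%:R <= 1 :> R.
Proof.
move=> off uni finG LG; set V := fset_set (vset G).
have finL := sub_finite_set LG finG.
have VG v : v \in V -> vset G v by rewrite in_fset_set // inE.
have cardL : #|` fset_set [set v | L G v]|%:R <=
    \sum_(v <- V) \1_[set v | L G v] v :> R.
  have -> : \sum_(v <- V) \1_[set v | L G v] v =
      (count (mem [set v | L G v]) V)%:R :> R.
    rewrite -sum1_count natr_sum [RHS]big_mkcond /=; apply: eq_bigr => v _.
    by rewrite indicE; case: (_ \in _).
  rewrite ler_nat -size_filter.
  apply: uniq_leq_size; first exact: fset_uniq.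
  move=> v; rewrite in_fset_set // mem_filter /= => Lv.
  by rewrite Lv in_fset_set // inE; apply: LG; exact: set_mem.
apply: (@le_trans _ _ (#|` V|%:R^-1 * \sum_(v <- V) 1)); last first.
  have -> : \sum_(v <- V) 1 = #|` V|%:R :> R by rewrite card_fset_sum1 natr_sum.
  have [->|V0] := eqVneq (#|` V|) 0%N; first by rewrite mulr0.
  by rewrite mulVf // pnatr_eq0.
rewrite /ball_frequency -/V -big_distrr /= -mulrDr.
apply: ler_wpM2l; first by rewrite invr_ge0.
apply: le_trans (lerD (lexx _) cardL) _.
rewrite exchange_big /= -big_split /= big_seq [leRHS]big_seq.
apply: ler_sum => v /VG Gv.
have [[i iM [Di vi]]|no] := pselect (exists2 i : 'I_M, true & D i /\
    ball_iso (S%:R : R) G v (H i)).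
  rewrite (bigD1 i) //= big1 => [|j /andP[Dj ji]].
    rewrite !indicE mem_set // memNset ?addr0 //.
    exact: off Gv Di vi.
  rewrite indicE memNset // => vj; move/eqP: ji; apply; apply/val_inj.
  exact: uni Gv Dj Di vj vi.
rewrite big1 ?add0r => [|i Di]; first by rewrite indicE lern1 leq_b1.
by rewrite indicE memNset // => vi; apply: no; exists i.
Qed.
End cells.

(** * Measurability for random finite graphs *)

Section random_measurable.
Context {d : measure_display} {Omega : measurableType d}.
Variable G : Omega -> mgraph.
Hypotheses (G_random : random_graph G) (G_fin : forall w, finite_set (vset (G w))).

Lemma measurable_eq_graph (g : mgraph) : measurable [set w | G w = g].
Proof.
case: G_random => mV mm.
have -> : [set w | G w = g] =
    \bigcap_i ([set w | vset (G w) i <-> vset g i] `&`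
      \bigcap_j [set w | mult (G w) i j = mult g i j]).
  apply/seteqP; split=> [w <- i _|w Gw]; first by split.
  apply: mgraph_ext => [|i j]; last by have [_ /(_ j I) ->] := Gw i I.
  by apply/seteqP; split=> i; have [[gi ig] _] := Gw i I.
apply: bigcapT_measurable => i; apply: measurableI.
  have [gi|ngi] := pselect (vset g i).
    by rewrite (_ : [set _ | _] = [set w | vset (G w) i]) //;
      apply/seteqP; split=> w /=; tauto.
  rewrite (_ : [set _ | _] = ~` [set w | vset (G w) i]); first exact: measurableC.
  by apply/seteqP; split=> w /=; tauto.
apply: bigcapT_measurable => j.
have := mm i j measurableT [set mult g i j] I.
by rewrite setTI.
Qed.

(** The event is a countable union of events [G w = g] with [g] finite, indexed
    here by the codes of the graphs [g]. *)
Lemma measurable_random_graph (Q : set mgraph) : measurable [set w | Q (G w)].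
Proof.
have /countable_injP[f f_inj] := countable_finite_mgraph.
have -> : [set w | Q (G w)] =
    \bigcup_n [set w | exists g, [/\ finite_set (vset g), Q g, f g = n & G w = g]].
  apply/seteqP; split=> [w Qw|w [n _ [g [_ Qg _ gw]]]].
    by exists (f (G w)) => //; exists (G w).
  by rewrite /= gw.
apply: bigcupT_measurable => n.
have [[g [fg Qg gn]]|no] := pselect (exists g, [/\ finite_set (vset g), Q g & f g = n]).
  rewrite (_ : [set _ | _] = [set w | G w = g]); first exact: measurable_eq_graph.
  apply/seteqP; split=> [w [h [fh Qh hn Gh]]|w Gw]; last by exists g.
  by rewrite /= Gh; apply: f_inj; rewrite ?inE ?hn.
rewrite (_ : [set _ | _] = set0) // -subset0 => w [g [fg Qg gn _]].
by apply: no; exists g.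
Qed.

Lemma measurable_fun_random_graph {R : realType} (F : mgraph -> R) :
  measurable_fun setT (fun w => F (G w)).
Proof.
by move=> _ Y mY; rewrite setTI; exact: (measurable_random_graph (F @^-1` Y)).
Qed.
End random_measurable.

(** * Limits of probabilities *)

Section probability_limits.
Context {d : measure_display} {Omega : measurableType d} {R : realType}.
Variable P : probability Omega R.

Lemma measurable_ltr_fun (f g : Omega -> R) :
  measurable_fun setT f -> measurable_fun setT g -> measurable [set w | f w < g w].
Proof.
move=> /measurable_EFinP mf /measurable_EFinP mg.
have := measurable_lte measurableT mf mg; rewrite setTI.
by under eq_set do rewrite /= lte_fin.
Qed.

Lemma cvg0_prob_lt (X : nat -> set Omega) : P (X n) @[n --> \oo] --> 0%E ->
  forall e : R, 0 < e -> \forall n \near \oo, (P (X n) < e%:E)%E.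
Proof.
move=> /fine_cvgP[fin X0] e e0.
have X_lt : \forall n \near \oo, fine (P (X n)) < e by exact: cvgr_lt X0 _ e0.
near=> n.
have fin_n : P (X n) \is a fin_num by near: n.
by rewrite -(fineK fin_n) lte_fin; near: n; exact: X_lt.
Unshelve. all: by end_near. Qed.

(** Measurability is what allows passing to the complement; it is only asked
    eventually, as nothing is assumed about the graph with index [0]. *)
Lemma cvg1_prob (E : nat -> set Omega) :
  (\forall n \near \oo, measurable (E n)) ->
  (forall e : R, 0 < e -> \forall n \near \oo, (P (~` E n) <= e%:E)%E) ->
  P (E n) @[n --> \oo] --> 1%E.
Proof.
move=> mE cE; apply/fine_cvgP; split.
  by apply: filterS mE => n mE; exact: fin_num_measure.
apply/cvgrPdist_le => e e0; have Ee_near := cE e e0; near=> n.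
have mEn : measurable (E n) by near: n.
have : (P (~` E n) <= e%:E)%E by near: n.
rewrite probability_setC //.
have := probability_le1 P mEn.
have : (P (E n)) \is a fin_num by exact: fin_num_measure.
rewrite /=; case: (P (E n)) => [p| |] //= _.
rewrite -EFinB !lee_fin => p1 Ee.
by rewrite ger0_norm // subr_ge0.
Unshelve. all: by end_near. Qed.

(** The events decrease in [n], and their intersection is empty by pointwise
    convergence, so this is continuity from above. *)
Lemma nonincreasing_cvg_prob (f_ : nat -> Omega -> R) (f : Omega -> R) (e : R) :
  (forall n, measurable_fun setT (f_ n)) -> measurable_fun setT f ->
  (forall w, {homo f_^~ w : n m / (n <= m)%N >-> m <= n}) ->
  (forall w, f_ n w @[n --> \oo] --> f w) -> 0 < e ->
  P [set w | f w + e < f_ n w] @[n --> \oo] --> 0%E.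
Proof.
move=> mf_ mf decr cvg_f e0.
have mX n : measurable [set w | f w + e < f_ n w].
  by apply: measurable_ltr_fun => //; exact: measurable_funD.
have X0 : \bigcap_n [set w | f w + e < f_ n w] = set0.
  rewrite -subset0 => w Xw.
  have f_lt : \forall n \near \oo, f_ n w < f w + e.
    by apply: cvgr_lt (cvg_f w) _ _; rewrite ltrDl.
  have [n] := filter_ex f_lt.
  by have := Xw n I; rewrite /= => /lt_trans h /h; rewrite ltxx.
rewrite -(measure0 P) -X0; apply: nonincreasing_cvg_mu => //.
- by apply: le_lt_trans (probability_le1 _ _) _ => //; rewrite ltry.
- by apply: bigcapT_measurable.
- move=> n m nm; apply/subsetPset => w /= h; exact: lt_le_trans h (decr _ _ _ nm).
Qed.

End probability_limits.

(** * Masses given by the random limit law *)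

Section kernel_mass.
Context {d d' : measure_display} {Omega : measurableType d} {Y : measurableType d'}.
Context {R : realType}.
Variable mu : R.-pker Omega ~> Y.
Implicit Types (A : set Y).

(** Real valued, so that masses can be subtracted and compared with
    frequencies. *)
Definition mass A (w : Omega) : R := fine (mu w A).

Lemma mass_le1 w A : measurable A -> (mu w A <= 1)%E.
Proof.
by move=> mA; rewrite -(@prob_kernel _ _ _ _ _ mu w) le_measure ?inE.
Qed.

Lemma massE w A : measurable A -> (mass A w)%:E = mu w A.
Proof.
move=> mA; rewrite fineK // ge0_fin_numE //.
by apply: le_lt_trans (mass_le1 _ mA) _; rewrite ltry.
Qed.

Lemma mass_ge0 w A : 0 <= mass A w.
Proof. exact: fine_ge0. Qed.

Lemma measurable_mass A : measurable A -> measurable_fun setT (mass A).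
Proof.
move=> mA; apply: (@measurableT_comp _ _ _ _ _ _ fine).
  exact: fine_measurable.
exact: measurable_kernel.
Qed.

Lemma mass_bigcap_cvg (A : nat -> set Y) w : (forall n, measurable (A n)) ->
  {homo A : n m / (n <= m)%N >-> (m <= n)%O} ->
  mass (A n) w @[n --> \oo] --> mass (\bigcap_n A n) w.
Proof.
move=> mA decr; apply: fine_cvg; rewrite massE; last exact: bigcapT_measurable.
apply: nonincreasing_cvg_mu => //; last exact: bigcapT_measurable.
by apply: le_lt_trans (mass_le1 _ (mA _)) _; rewrite ltry.
Qed.

Lemma le_mass w A B : measurable A -> measurable B -> A `<=` B ->
  mass A w <= mass B w.
Proof. by move=> mA mB AB; rewrite -lee_fin !massE // le_measure ?inE. Qed.

Lemma massC w A : measurable A -> mass (~` A) w = 1 - mass A w.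
Proof.
move=> mA; apply: (@EFin_inj R); rewrite EFinB !massE //; last exact: measurableC.
have muT : mu w [set: Y] = 1%E by exact: prob_kernel.
transitivity (mu w [set: Y] - mu w A)%E; last by rewrite muT.
rewrite -setTD measureD ?setTI //.
by apply: (@le_lt_trans _ _ 1%E); [exact: mass_le1|rewrite ltry].
Qed.

Lemma mass_cells_cvg (B : nat -> set Y) w : (forall n, measurable (B n)) ->
  trivIset setT B ->
  1 - \sum_(i < n) mass (B i) w @[n --> \oo] --> mass (~` \bigcup_i B i) w.
Proof.
move=> mB tB; have mU : measurable (\bigcup_i B i) by exact: bigcupT_measurable.
rewrite massC //; apply: cvgB; first exact: cvg_cst.
suff : (\sum_(i < n) mass (B i) w)%:E @[n --> \oo] -->
    (mass (\bigcup_i B i) w)%:E by move=> /fine_cvgP[].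
rewrite massE //; have := @measure_semi_sigma_additive _ _ _ (mu w) B mB tB mU.
apply: cvg_trans; apply: near_eq_cvg; apply: nearW => n /=.
by rewrite big_mkord -sumEFin; apply: eq_bigr => i _; rewrite massE.
Qed.

End kernel_mass.

(** * Frequencies of local events *)

Section local_events.
Context {R : realType} {d : measure_display} {Omega : measurableType d}.
Variables (P : probability Omega R) (G : nat -> Omega -> mgraph).
Hypothesis G_random : forall n, (0 < n)%N -> random_graph (G n).
Hypothesis G_card : forall n w, (0 < n)%N -> vset (G n w) #= `I_n.
Variable mu : R.-pker Omega ~> Gstar R.
Hypothesis G_cvg : local_cvg_in_probability P G mu.

Let G_fin n w : (0 < n)%N -> finite_set (vset (G n w)).
Proof. by move=> n0; apply/finite_setP; exists n; exact: G_card. Qed.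

Variables (S : nat) (L : mgraph -> nat -> Prop).
Hypothesis S_gt0 : (0 < S)%N.
Hypothesis L_local : forall (G H : mgraph) v w, vset G v ->
  rooted_iso (gball G (S%:R : R) v) v (gball H (S%:R : R) w) w -> L G v -> L H w.
Hypothesis L_vset : forall (G : mgraph) v, L G v -> vset G v.

Definition frequency (g : mgraph) : R :=
  #|` fset_set (vset g)|%:R^-1 * #|` fset_set [set v | L g v]|%:R.

Lemma measurable_local_event : measurable ([set x : rgraph | L x (root x)] : set (Gstar R)).
Proof.
apply: (@measurable_local _ S) => x y Lx xy.
by apply: L_local xy Lx; exact: root_vset.
Qed.

(** One minus the mass of the first [M] cells decreases to the mass of what lies
    in no cell, which is at most the mass of the event.  So one [M], chosen before
    [n], makes the difference at most [e / 2] outside a set [X] of small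
    probability.  The frequencies of the [M] cells are then each close to their
    masses, and their sum bounds the frequency of the event from above by
    [frequency_cells_le]. *)
Lemma local_event_frequency (e delta : R) : 0 < e -> 0 < delta ->
  \forall n \near \oo,
    (P [set w | (mass mu ([set x : rgraph | L x (root x)] : set (Gstar R)) w + e
                < frequency (G n w))%R] <= delta%:E)%E.
Proof.
move=> e0 delta0; set A : set (Gstar R) := [set x : rgraph | L x (root x)].
have mA : measurable A by exact: measurable_local_event.
have [H [D [off uni onto]]] := complement_cells L_local.
pose T i : set (Gstar R) := [set x : rgraph | ball_iso (S%:R : R) x (root x) (H i)].
pose B i := if D i then T i else set0.
have mT i : measurable (T i) by exact: measurable_ball_iso.
have mB i : measurable (B i) by rewrite /B; case: ifP.
have mBD i w : mass mu (B i) w = if D i then mass mu (T i) w else 0.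
  by rewrite /B; case: ifP => // _; rewrite /mass measure0.
have tB : trivIset setT B.
  move=> i j _ _ [x []]; rewrite /B; case: ifP => // Di xi; case: ifP => // Dj xj.
  by apply: uni xi xj => //; exact: root_vset.
have mUB : measurable (~` \bigcup_i B i).
  by apply: measurableC; exact: bigcupT_measurable.
have BA : ~` (\bigcup_i B i) `<=` A.
  move=> x xB; apply: contrapT => nLx; apply: xB.
  by have [i Di xi] := onto x nLx; exists i => //; rewrite /B Di.
pose t M w : R := 1 - \sum_(i < M) mass mu (B i) w.
have e20 : 0 < e / 2 by rewrite divr_gt0.
have d20 : 0 < delta / 2 by rewrite divr_gt0.
have mt M : measurable_fun setT (t M).
  apply: measurable_funB; first exact: measurable_cst.
  by apply: measurable_sum => i; exact: measurable_mass.
have /cvg0_prob_lt/(_ _ d20)/filter_ex[M XM] :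
    P [set w | mass mu (~` \bigcup_i B i) w + e / 2 < t M w] @[M --> \oo] --> 0%E.
  apply: nonincreasing_cvg_prob => //; first exact: measurable_mass.
    move=> w m n mn; rewrite lerD2l lerN2 -!(big_mkord xpredT (fun i => mass mu (B i) w)).
    by rewrite (big_cat_nat (leq0n m) mn) //= lerDl sumr_ge0 // => i _; exact: mass_ge0.
  by move=> w; exact: mass_cells_cvg.
set X := [set w | _] in XM.
have mX : measurable X.
  apply: measurable_ltr_fun => //; apply: measurable_funD => //.
  exact: measurable_mass.
(* [M.+1] rather than [M] avoids dividing by [0]. *)
pose e' := e / 2 / M.+1%:R.
have e'0 : 0 < e' by rewrite divr_gt0.
pose C n i := if D i then
  [set w | e' < `|ball_frequency (S%:R : R) (G n w) (H i) - mass mu (T i) w|] else set0.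
have mC n i : (0 < n)%N -> measurable (C n i).
  move=> n0; rewrite /C; case: ifP => // _; apply: measurable_ltr_fun => //.
  apply: (@measurableT_comp _ _ _ _ _ _ (@Num.norm R R)) => //.
  apply: measurable_funB; last exact: measurable_mass.
  apply: (measurable_fun_random_graph (G_random n0) _
    (fun g => ball_frequency (S%:R : R) g (H i))) => w; exact: G_fin.
have d'0 : 0 < delta / 2 / M.+1%:R by rewrite divr_gt0.
have C_small : \forall n \near \oo, forall i : 'I_M,
    (P (C n i) < (delta / 2 / M.+1%:R)%:E)%E.
  apply: filter_forall => i; rewrite /C; case: (D i).
    apply: cvg0_prob_lt => //; apply: G_cvg => //.
    by rewrite ltr0n.
  by apply: nearW => n; rewrite measure0 lte_fin.
near=> n.
have n0 : (0 < n)%N by near: n; exact: nbhs_infty_gt.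
have Cn : forall i : 'I_M, (P (C n i) < (delta / 2 / M.+1%:R)%:E)%E by near: n.
set Bad := [set w | _].
have mBad : measurable Bad.
  apply: measurable_ltr_fun.
    by apply: measurable_funD => //; exact: measurable_mass.
  by apply: (measurable_fun_random_graph (G_random n0) _ frequency) => w; exact: G_fin.
(* [X] and the [M] events of a bad cell frequency, as one sequence. *)
pose F i := if i is j.+1 then C n j else X.
have BadF : Bad `<=` \big[setU/set0]_(i < M.+1) F i.
  move=> w Badw; rewrite -bigcup_mkord; apply: contrapT => nF.
  have nX : ~ X w by move=> Xw; apply: nF; exists 0%N.
  have nC (i : 'I_M) : ~ C n i w.
    by move=> Ciw; apply: nF; exists i.+1 => //=; rewrite ltnS.
  have sum_close : \sum_(i < M) mass mu (B i) w - e / 2 <=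
      \sum_(i < M | D i) ball_frequency (S%:R : R) (G n w) (H i).
    have -> : \sum_(i < M) mass mu (B i) w = \sum_(i < M | D i) mass mu (T i) w.
      by rewrite [RHS]big_mkcond /=; apply: eq_bigr => i _; rewrite mBD.
    rewrite lerBlDr -lerBlDl -sumrB.
    apply: (@le_trans _ _ (\sum_(i < M) e')).
      rewrite [leLHS]big_mkcond /=; apply: ler_sum => i _.
      case: ifPn => Di; last exact: ltW.
      have := nC i; rewrite /C Di /= => /negP; rewrite -leNgt.
      apply: le_trans.
      by rewrite distrC ler_norm.
    rewrite sumr_const card_ord -[leLHS]mulr_natr /e' [leLHS]mulrAC.
    by rewrite ler_pdivrMr // ler_pM2l // ler_nat.
  have := @frequency_cells_le R S L H D (G n w) M
    (fun v i => @off (G n w) v i) (fun v i j => @uni (G n w) v i j) (G_fin w n0)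
    (@L_vset (G n w)).
  rewrite -/(frequency (G n w)) => freq_le.
  move/negP: nX; rewrite /= -leNgt => t_le.
  have A_ge := le_mass mu w mUB mA BA.
  move: Badw; rewrite /Bad /=; apply/negP; rewrite -leNgt.
  rewrite /t in t_le.
  by lra.
apply: le_trans (content_subadditive P _ mBad BadF) _.
  by case=> [|i] _ //=; exact: mC.
rewrite big_ord_recl /= [in leRHS](splitr delta) EFinD; apply: leeD; first exact: ltW.
apply: (@le_trans _ _ (\sum_(i < M) (delta / 2 / M.+1%:R)%:E)%E).
  by apply: lee_sum => i _; exact: ltW (Cn i).
rewrite sumEFin lee_fin sumr_const card_ord -[leLHS]mulr_natr [leLHS]mulrAC.
by rewrite ler_pdivrMr // ler_pM2l // ler_nat.
Unshelve. all: by end_near. Qed.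

End local_events.

(** * Upper bound on the giant component *)

Theorem corollary1p1 (R : realType) (d : measure_display)
  (Omega : measurableType d) (P : probability Omega R)
  (c : mgraph -> nat -> R) (c_ge0 : centrality c) (c_local : strictly_local c)
  (r : R)
  (G : nat -> Omega -> mgraph)
  (G_random : forall n, (0 < n)%N -> random_graph (G n))
  (G_card : forall n w, (0 < n)%N -> vset (G n w) #= `I_n)
  (mu : R.-pker Omega ~> Gstar R)
  (G_cvg : local_cvg_in_probability P G mu)
  (eps : R) (eps_gt0 : 0 < eps) :
  P [set w | (giant_size (killed c r (G n w)))%:R <= n%:R * (zeta c r mu w + eps)]
    @[n --> \oo] --> 1%E.
Proof.
have [N cN] := c_local.
pose L k (g : mgraph) v := large k (killed c r g) v.
(* Radius [k + N] would do, but it may be [0], and local convergence speaks of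
   positive radii only. *)
have L_local k (g h : mgraph) v w : vset g v ->
    rooted_iso (gball g ((k + N).+1%:R : R) v) v
               (gball h ((k + N).+1%:R : R) w) w -> L k g v -> L k h w.
  move=> gv gh; apply: (large_local cN gv); apply: ball_iso_le gh => //.
  by rewrite ler_nat.
have L_vset k (g : mgraph) v : L k g v -> vset g v by move=> /large_vset[].
pose A k : set (Gstar R) := [set x : rgraph | L k x (root x)].
have mA k : measurable (A k) by exact: measurable_local_event (@L_local k).
have A_anti : {homo A : k m / (k <= m)%N >-> (m <= k)%O}.
  by move=> k m km; apply/subsetPset => x; exact: large_leq.
have zetaE w : zeta c r mu w = mass mu (\bigcap_k A k) w.
  rewrite /zeta /mass; congr (fine (mu w _)); apply/seteqP; split=> x /=.
    by move=> /infinite_componentP h k _; exact: h.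
  by move=> h; apply/infinite_componentP => k; exact: h k I.
have mzeta : measurable_fun setT (zeta c r mu).
  rewrite (_ : zeta c r mu = mass mu (\bigcap_k A k)); last exact/funext.
  by apply: measurable_mass; exact: bigcapT_measurable.
have G_fin n w : (0 < n)%N -> finite_set (vset (G n w)).
  by move=> n0; apply/finite_setP; exists n; exact: G_card.
have m_good n : (0 < n)%N -> measurable
    [set w | (giant_size (killed c r (G n w)))%:R <= n%:R * (zeta c r mu w + eps)].
  move=> n0; rewrite -[X in measurable X]setCK; apply: measurableC.
  rewrite (_ : ~` _ = [set w | n%:R * (zeta c r mu w + eps) <
      (giant_size (killed c r (G n w)))%:R]); last first.
    by apply/seteqP; split=> w /=; rewrite ltNge => /negP.
  apply: measurable_ltr_fun.
    by apply: measurable_funM => //; exact: measurable_funD.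
  apply: (measurable_fun_random_graph (G_random _ n0) _
    (fun g => (giant_size (killed c r g))%:R)) => w; exact: G_fin.
apply: cvg1_prob => [|delta delta0]; first by exists 1%N.
have e20 : 0 < eps / 2 by rewrite divr_gt0.
have d20 : 0 < delta / 2 by rewrite divr_gt0.
(* [k] is fixed here, before [n]; it depends on [delta] because [zeta] is random
   and the masses need not converge to it uniformly. *)
have [k Xk] : exists k,
    (P [set w | (zeta c r mu w + eps / 2 < mass mu (A k) w)%R] < (delta / 2)%:E)%E.
  have X0 : P [set w | zeta c r mu w + eps / 2 < mass mu (A k) w] @[k --> \oo] --> 0%E.
    apply: nonincreasing_cvg_prob => //.
    - by move=> k; exact: measurable_mass.
    - move=> w m n mn; apply: le_mass => //.
      by apply/subsetPset; exact: A_anti.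
    - by move=> w; rewrite zetaE; exact: mass_bigcap_cvg.
  exact: filter_ex (cvg0_prob_lt X0 d20).
set X := [set w | _] in Xk.
have mX : measurable X.
  apply: measurable_ltr_fun; last exact: measurable_mass.
  exact: measurable_funD.
have freq_le := local_event_frequency G_random G_card G_cvg (ltn0Sn _)
  (@L_local k) (@L_vset k) e20 d20.
near=> n.
have n0 : (0 < n)%N by near: n; exact: nbhs_infty_gt.
have k_le : k%:R <= n%:R * eps.
  by rewrite -ler_pdivrMr //; near: n; exact: nbhs_infty_ger.
have Fn : (P [set w | (mass mu (A k) w + eps / 2 < frequency (L k) (G n w))%R]
    <= (delta / 2)%:E)%E by near: n.
set F := [set w | _] in Fn.
have mF : measurable F.
  apply: measurable_ltr_fun.
    by apply: measurable_funD => //; exact: measurable_mass.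
  by apply: (measurable_fun_random_graph (G_random _ n0) _ (frequency (L k))) => w;
    exact: G_fin.
set E := ~` _.
(* Outside [X] and [F], [giant_size / n] is at most [k / n <= eps] or at most
   [frequency (L k) <= mass (A k) + eps / 2 <= zeta + eps]. *)
have EXF : E `<=` X `|` F.
  move=> w; apply: contraPP => /not_orP[/negP]; rewrite /= -leNgt => Xw.
  move=> /negP; rewrite /= -leNgt => Fw; apply.
  have zeta0 : 0 <= zeta c r mu w by exact: fine_ge0.
  have nR0 : 0 < n%:R :> R by rewrite ltr0n.
  have finK : finite_set (vset (killed c r (G n w))).
    by apply: sub_finite_set (G_fin n w n0) => v [].
  have := giant_size_le k finK; rewrite -(ler_nat R) => /le_trans; apply.
  rewrite natr_max ge_max; apply/andP; split.
    by apply: le_trans k_le _; rewrite ler_pM2l // lerDr.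
  rewrite mulrC -ler_pdivrMr // mulrC.
  move: Fw; rewrite /frequency (card_fset_set (G_card n w n0)) /L.
  by move=> /le_trans; apply; lra.
have mE : measurable E by apply: measurableC; exact: m_good.
rewrite (splitr delta) EFinD.
apply: le_trans (le_measure P _ _ EXF) _; rewrite ?inE //; first exact: measurableU.
apply: le_trans (measureU2 P mX mF) _; apply: leeD => //; exact: ltW.
Unshelve. all: by end_near. Qed.
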